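(* Let $A=\Bbbk[u]/(u^4-1)$. By defining $g\cdot u=\zeta u$ for $\zeta\in\Bbbk$ a primitive fourth root of unity and $x\cdot u=\gamma u^3$ for $\gamma\in\Bbbk$ satisfying $\gamma^2=2\zeta$, one obtains that $A$ is a $T(4,2,1)$-module algebra of the form $A(T(4,2,1))$. Moreover, this gives all the possible $T(4,2,1)$-module algebra structures $A(T(4,2,1))$.
   Context: $\Bbbk$ is an algebraically closed field of characteristic $0$. $T(4,2,1)$ is the Hopf algebra generated by a grouplike element $g$ and an element $x$ with $\Delta(x)=g\otimes x+x\otimes 1$, subject to $g^4=1$, $x^2=g^2-1$, $gx=-xg$. Its group of grouplike elements is $\langle g\rangle$, cyclic of order $4$. For a Hopf algebra $H$, an $H$-module algebra is an algebra $A$ that is a left $H$-module with $h\cdot(ab)=(h_{(1)}\cdot a)(h_{(2)}\cdot b)$ and $h\cdot 1_A=\epsilon(h)1_A$. The action is inner-faithful if $I\cdot A\neq 0$ for every nonzero Hopf ideal $I$ of $H$. $A(H)$: for a Hopf algebra $H$ whose group $G$ of grouplike elements is finite abelian, $A(H)$ denotes an inner-faithful $H$-module algebra isomorphic to $\Bbbk G$ as an algebra, on which $\Bbbk G\subset H$ acts through an identification $G\cong\widehat G$ (character group), $\widehat G$ acting on $\Bbbk G$ by $\chi\cdot h=\langle\chi,h\rangle h$ for $h\in G$. For $H=T(4,2,1)$ this means an inner-faithful $T(4,2,1)$-module algebra which as an algebra is $\Bbbk[u]/(u^4-1)$, with $g\cdot u=\zeta u$ for a primitive fourth root of unity $\zeta$.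 *)

(* Defs.v *)
From HB Require Import structures.
From mathcomp Require Import all_boot all_order all_algebra all_field.

Set Implicit Arguments.
Unset Strict Implicit.
Unset Printing Implicit Defensive.

Import GRing.Theory.
Local Open Scope ring_scope.

(* V (x) W for finite-dimensional V and W, in coordinates: the (i, j) entry of *)
(* a tensor is its coefficient on e_i (x) e'_j, where e and e' are the bases   *)
(* vbasis {:V} and vbasis {:W}.                                                *)
Definition tensor (k : fieldType) (V W : vectType k) :=
  'M[k]_(\dim {:V}, \dim {:W}).

Definition tens (k : fieldType) (V W : vectType k) (v : V) (w : W) :
    tensor V W :=
  \matrix_(i, j) (coord (vbasis {:V}) i v * coord (vbasis {:W}) j w).

(* The linear map V (x) W -> U induced by a bilinear f; with t = Delta h, it   *)
(* renders the Sweedler expression f h_(1) h_(2).                              *)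
Definition tens_lift (k : fieldType) (V W : vectType k) (U : lmodType k)
    (f : V -> W -> U) (t : tensor V W) : U :=
  \sum_i \sum_j t i j *: f (vbasis {:V})`_i (vbasis {:W})`_j.

Lemma tens_lift_tens (k : fieldType) (V W : vectType k) (U : lmodType k)
    (f : V -> W -> U) (v : V) (w : W) :
  (forall w' : W, linear (f^~ w')) -> (forall v' : V, linear (f v')) ->
  tens_lift f (tens v w) = f v w.
Proof.
move=> fl fr.
pose F1 w' : {linear V -> U} := HB.pack (f^~ w')
  (GRing.isLinear.Build k V U *:%R (f^~ w') (fl w')).
pose F2 v' : {linear W -> U} := HB.pack (f v')
  (GRing.isLinear.Build k W U *:%R (f v') (fr v')).
rewrite {2}(coord_vbasis (memvf v)) -[f _ w]/(F1 w _) linear_sum.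
apply: eq_bigr => i _; rewrite linearZ /= {2}(coord_vbasis (memvf w)).
rewrite -[f _ _ in RHS]/(F2 _ _) linear_sum scaler_sumr; apply: eq_bigr => j _.
by rewrite linearZ /= mxE scalerA.
Qed.

(* The image of X (x) Y in V (x) W. *)
Definition tensv (k : fieldType) (V W : vectType k)
    (X : {vspace V}) (Y : {vspace W}) : {vspace 'M[k]_(\dim {:V}, \dim {:W})} :=
  <<[seq tens v w | v <- vbasis X, w <- vbasis Y]>>%VS.

Record hopf (k : fieldType) (H : falgType k) := Hopf {
  Delta : {linear H -> 'M[k]_(\dim {:H}, \dim {:H})};
  counit : {lrmorphism H -> k^o};
  antipode : {linear H -> H};
  Delta1 : Delta 1 = tens 1 1;
  DeltaM : forall a b : H,
    Delta (a * b) =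
      tens_lift (fun a1 a2 =>
        tens_lift (fun b1 b2 => tens (a1 * b1) (a2 * b2)) (Delta b)) (Delta a);
  (* both sides are taken in (H (x) H) (x) H *)
  coassoc : forall h : H,
    tens_lift (fun h1 h2 => tens (Delta h1) h2) (Delta h) =
    tens_lift (fun h1 h2 =>
      tens_lift (fun h21 h22 => tens (tens h1 h21) h22) (Delta h2)) (Delta h);
  counitl : forall h : H, tens_lift (fun h1 h2 => counit h1 *: h2) (Delta h) = h;
  counitr : forall h : H, tens_lift (fun h1 h2 => counit h2 *: h1) (Delta h) = h;
  antipodel : forall h : H,
    tens_lift (fun h1 h2 => antipode h1 * h2) (Delta h) = (counit h : k) *: 1;
  antipoder : forall h : H,
    tens_lift (fun h1 h2 => h1 * antipode h2) (Delta h) = (counit h : k) *: 1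
}.

Definition hopf_ideal (k : fieldType) (H : falgType k) (S : hopf H)
    (I : {vspace H}) : Prop :=
  [/\ forall a b : H, a \in I -> (a * b \in I) /\ (b * a \in I),
      forall a : H, a \in I -> Delta S a \in (tensv I {:H} + tensv {:H} I)%VS,
      forall a : H, a \in I -> counit S a = 0
    & forall a : H, a \in I -> antipode S a \in I].

Record module_algebra (k : fieldType) (H : falgType k) (S : hopf H)
    (B : algType k) := ModuleAlgebra {
  act :> H -> B -> B;
  act_linearl : forall b : B, linear (act^~ b);
  act_linearr : forall h : H, linear (act h);
  act1 : forall b : B, act 1 b = b;
  actM : forall (h h' : H) (b : B), act (h * h') b = act h (act h' b);
  act_mul : forall (h : H) (a b : B),
    act h (a * b) = tens_lift (fun h1 h2 => act h1 a * act h2 b) (Delta S h);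
  act_one : forall h : H, act h 1 = (counit S h : k) *: 1
}.

Definition inner_faithful (k : fieldType) (H : falgType k) (S : hopf H)
    (B : algType k) (M : module_algebra S B) : Prop :=
  forall I : {vspace H}, hopf_ideal S I -> I != 0%VS ->
    exists2 h : H, h \in I & exists b : B, M h b != 0.

Definition T421_relations (k : fieldType) (B : algType k) (g x : B) : Prop :=
  [/\ g ^+ 4 = 1, x ^+ 2 = g ^+ 2 - 1 & g * x = - (x * g)].

(* H is the algebra presented by the generators g and x and these relations. *)
Definition T421_presentation (k : fieldType) (H : falgType k) (g x : H) :
    Prop :=
  [/\ T421_relations g x,
      forall (B : algType k) (b c : B), T421_relations b c ->
        exists f : {lrmorphism H -> B}, f g = b /\ f x = c
    & forall (B : algType k) (f f' : {lrmorphism H -> B}),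
        f g = f' g -> f x = f' x -> f =1 f'].

(* H, with the Hopf structure S, is T(4,2,1) on the generators g and x; the    *)
(* counit and the antipode are determined by the comultiplication.             *)
Definition is_T421 (k : fieldType) (H : falgType k) (S : hopf H) (g x : H) :
    Prop :=
  [/\ T421_presentation g x, Delta S g = tens g g
    & Delta S x = tens g x + tens x 1].

(* k[u]/(u^4 - 1).  As 'X^4 - 1 is monic of size 5, the coercion to a monic    *)
(* polynomial built into {poly %/ _} leaves it unchanged.                      *)
Definition Aalg (k : fieldType) : comAlgType k :=
  {poly %/ ('X^4 - 1 : {poly k})}.

Definition Agen (k : fieldType) : Aalg k := in_qpoly ('X^4 - 1) 'X.

(* M is of the form A(T(4,2,1)), f being the identification of the underlying  *)
(* algebra with k[u]/(u^4 - 1).                                                *)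
Definition A_T421 (k : fieldType) (H : falgType k) (S : hopf H) (g : H)
    (B : algType k) (M : module_algebra S B) (f : {lrmorphism Aalg k -> B}) :
    Prop :=
  [/\ inner_faithful M, bijective f
    & exists2 zeta : k, 4.-primitive_root zeta
        & M g (f (Agen k)) = zeta *: f (Agen k)].

(* Main.v *)
Require Import Defs.
From HB Require Import structures.
From mathcomp Require Import all_boot all_order all_algebra all_field.

Set Implicit Arguments.
Unset Strict Implicit.
Unset Printing Implicit Defensive.

Import GRing.Theory.
Local Open Scope ring_scope.

(* Let sigma be the automorphism u |-> zeta u of A = k[u]/(u^4 - 1) and put    *)
(* c = gamma / (zeta - 1), so that c^2 = -1.  The formula for x extends to the *)
(* inner skew derivation a |-> c u^2 (sigma a - a), for which the relations of *)
(* T(4,2,1) are immediate; the universal property of H then gives the action,  *)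
(* and g^i, g^i x (i < 4) span H.  A Hopf ideal I acting by zero on A also     *)
(* acts by zero on A (x) A; writing h in I as p(g) + q(g) x, the coefficient   *)
(* of u^n in h.u^n gives p(zeta^n) = 0, and that of u^n (x) 1 in               *)
(* h.(u^n (x) u^2) gives q(zeta^n) = 0, for all n, so h = 0.  Conversely       *)
(* g x = - x g puts x.u in the (-zeta)-eigenspace of g, which is k u^3, and    *)
(* then x^2 = g^2 - 1 applied to u determines gamma^2.                         *)

(** Since [H] is given by a presentation, an action is a pair of operators on A satisfying the three
    relations ([T421_rep]), and the module-algebra axioms need checking only along left
    multiplication by [g] and [x] ([T421_ind]). There they say that [g] acts by an algebra map sigma
    and [x] by a skew derivation: x.(ab) = (g.a)(x.b) + (x.a)b. The candidate a |-> w (sigma a - a)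
    with w = c u^2 obeys this rule because A is commutative ([skew_derM]). It anticommutes with
    sigma because sigma w = - w, and its square is sigma^2 - 1 because w^2 = c^2 u^4 = -1
    ([skew_der_sqr]). [T421_act_exists] assembles the action; [T421_act_uniq] shows that its values
    on u determine it.

    The action is not faithful: [x] kills 1, and (1 - g + g^2 - g^3) x acts on A by zero. So an
    ideal acting by zero must also be tested on A (x) A, where the coideal condition applies; this
    is [T421_ideal_trivial].

    Conversely, g acts on the powers of u with distinct eigenvalues, so the anticommutation relation
    alone puts x.u on the line of u^3 ([skew_eigen]), and the relation for x^2 fixes gamma^2
    ([skew_weight]). *)

Lemma linear_fun (k : nzRingType) (V W : lmodType k) (f : V -> W) :
  linear f -> exists F : {linear V -> W}, f =1 F.
Proof.
by move=> lf; exists (HB.pack_for {linear V -> W} f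
  (GRing.isLinear.Build k V W *:%R f lf)).
Qed.

Lemma tens_lift_linear (k : fieldType) (V W : vectType k) (U : lmodType k)
    (f : V -> W -> U) : linear (tens_lift f).
Proof.
move=> c s t; rewrite /tens_lift scaler_sumr -big_split; apply: eq_bigr => i _.
rewrite scaler_sumr -big_split; apply: eq_bigr => j _.
by rewrite !mxE scalerDl scalerA.
Qed.

Lemma linear_tens_lift (k : fieldType) (V W : vectType k) (U U' : lmodType k)
    (f : V -> W -> U) (t : tensor V W) (L : U -> U') :
  linear L -> L (tens_lift f t) = tens_lift (fun v w => L (f v w)) t.
Proof.
case/linear_fun=> F LF; rewrite LF linear_sum; apply: eq_bigr => i _.
rewrite linear_sum; apply: eq_bigr => j _.
by rewrite linearZ /= LF.
Qed.

Lemma tens_lift_param_linear (k : fieldType) (V W : vectType k)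
    (U U' : lmodType k) (f : U' -> V -> W -> U) (t : tensor V W) :
  (forall v w, linear (fun u => f u v w)) ->
  linear (fun u => tens_lift (f u) t).
Proof.
move=> lf c u u'; rewrite /tens_lift scaler_sumr -big_split.
apply: eq_bigr => i _; rewrite scaler_sumr -big_split; apply: eq_bigr => j _.
by rewrite lf scalerDr !scalerA mulrC.
Qed.

Lemma eq_tens_lift (k : fieldType) (V W : vectType k) (U : lmodType k)
    (f f' : V -> W -> U) (t : tensor V W) :
  f =2 f' -> tens_lift f t = tens_lift f' t.
Proof.
by move=> ff'; apply: eq_bigr => i _; apply: eq_bigr => j _; rewrite ff'.
Qed.

Lemma tens_linearl (k : fieldType) (V W : vectType k) (w : W) :
  linear (fun v : V => tens v w).
Proof.
by move=> c v v'; apply/matrixP => i j; rewrite !mxE linearP mulrDl mulrA.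
Qed.

Lemma tens_linearr (k : fieldType) (V W : vectType k) (v : V) :
  linear (fun w : W => tens v w).
Proof.
by move=> c w w'; apply/matrixP => i j; rewrite !mxE linearP mulrDr mulrCA.
Qed.

Definition bilin (k : nzRingType) (V W U : lmodType k) (f : V -> W -> U) :=
  (forall w, linear (f^~ w)) /\ (forall v, linear (f v)).

Lemma tens_lift_bilin (k : fieldType) (V W : vectType k) (U : lmodType k)
    (f : V -> W -> U) v w : bilin f -> tens_lift f (tens v w) = f v w.
Proof. by case; exact: tens_lift_tens. Qed.

(** Bilinearity of the inner sum over [Delta b] lets the outer one be evaluated at pure tensors such
    as [tens g g]. *)
Lemma bilin_tens_mul (k : fieldType) (H : falgType k) (U : lmodType k)
    (f : H -> H -> U) (t : tensor H H) : bilin f ->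
  bilin (fun a1 a2 => tens_lift (fun b1 b2 => f (a1 * b1) (a2 * b2)) t).
Proof.
case=> fl fr; split=> u; apply: tens_lift_param_linear => v w c a b;
  by rewrite mulrDl -scalerAl ?fl ?fr.
Qed.

Lemma tens_bilin (k : fieldType) (V W : vectType k) : bilin (@tens k V W).
Proof. by split=> u; [apply: tens_linearl | apply: tens_linearr]. Qed.

Lemma tens_lift_DeltaM (k : fieldType) (H : falgType k) (S : hopf H)
    (U : lmodType k) (f : H -> H -> U) (a b : H) : bilin f ->
  tens_lift f (Delta S (a * b)) =
  tens_lift (fun a1 a2 =>
    tens_lift (fun b1 b2 => f (a1 * b1) (a2 * b2)) (Delta S b)) (Delta S a).
Proof.
move=> bf; rewrite DeltaM linear_tens_lift; last exact: tens_lift_linear.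
apply: eq_tens_lift => a1 a2.
rewrite linear_tens_lift; last exact: tens_lift_linear.
by apply: eq_tens_lift => b1 b2; rewrite tens_lift_bilin.
Qed.

Lemma tens_lift_grouplikeM (k : fieldType) (H : falgType k) (S : hopf H)
    (U : lmodType k) (f : H -> H -> U) (g b : H) :
    bilin f -> Delta S g = tens g g ->
  tens_lift f (Delta S (g * b)) =
  tens_lift (fun b1 b2 => f (g * b1) (g * b2)) (Delta S b).
Proof.
by move=> bf Dg; rewrite tens_lift_DeltaM // Dg tens_lift_bilin //;
  apply: bilin_tens_mul.
Qed.

Lemma tens_liftD (k : fieldType) (V W : vectType k) (U : lmodType k)
    (f : V -> W -> U) s t :
  tens_lift f (s + t) = tens_lift f s + tens_lift f t.
Proof. by have := tens_lift_linear f 1 s t; rewrite !scale1r. Qed.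

(** This is Delta(x b) = (g (x) x + x (x) 1) Delta(b), paired with [f]. With [tens_lift_grouplikeM]
    it drives inductions along left multiplication by the generators. *)
Lemma tens_lift_skewM (k : fieldType) (H : falgType k) (S : hopf H)
    (U : lmodType k) (f : H -> H -> U) (g x b : H) :
    bilin f -> Delta S x = tens g x + tens x 1 ->
  tens_lift f (Delta S (x * b)) =
  tens_lift (fun b1 b2 => f (g * b1) (x * b2) + f (x * b1) b2) (Delta S b).
Proof.
move=> bf Dx; have bm := bilin_tens_mul (Delta S b) bf.
rewrite tens_lift_DeltaM // Dx tens_liftD !tens_lift_bilin //.
rewrite /tens_lift -big_split; apply: eq_bigr => i _.
by rewrite -big_split; apply: eq_bigr => j _; rewrite mul1r scalerDr.
Qed.

(** * Hopf ideals and the counit *)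

Lemma tensv_kill (k : fieldType) (V W : vectType k) (U : vectType k)
    (f : V -> W -> U) (X : {vspace V}) (Y : {vspace W}) t : bilin f ->
  (forall v w, v \in X -> w \in Y -> f v w = 0) ->
  t \in tensv X Y -> tens_lift f t = 0.
Proof.
move=> bf f0 tXY; have [F FE] := linear_fun (tens_lift_linear f).
suff /subvP/(_ t tXY): (tensv X Y <= lker (linfun F))%VS.
  by rewrite memv_ker lfunE /= FE => /eqP.
apply/span_subvP => _ /allpairsP[[v w] [vX wY ->]] /=.
by rewrite memv_ker lfunE /= -FE tens_lift_bilin // f0 // vbasis_mem.
Qed.

(** [Delta] sends [I] into I (x) H + H (x) I, and [f] vanishes on both summands. *)
Lemma hopf_ideal_kill (k : fieldType) (H : falgType k) (S : hopf H)
    (U : vectType k) (I : {vspace H}) (f : H -> H -> U) h : hopf_ideal S I ->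
  bilin f -> (forall a b, a \in I -> f a b = 0 /\ f b a = 0) ->
  h \in I -> tens_lift f (Delta S h) = 0.
Proof.
case=> _ cI _ _ bf f0 /cI/memv_addP[s sI [t tI ->]].
rewrite tens_liftD (tensv_kill bf _ sI) ?(tensv_kill bf _ tI) ?addr0 //.
  by move=> v w _ /f0-/(_ v)[].
by move=> v w /f0-/(_ w)[].
Qed.

Lemma counit_scale_bilin (k : fieldType) (H : falgType k) (S : hopf H) :
  bilin (fun h1 h2 : H => (counit S h1 : k) *: h2).
Proof.
split=> w c u v; last by rewrite scalerDr !scalerA mulrC.
by rewrite [counit S _]linearP scalerDl -scalerA.
Qed.

Lemma counit_grouplike (k : fieldType) (H : falgType k) (S : hopf H) (g : H) :
  Delta S g = tens g g -> g != 0 -> counit S g = 1 :> k.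
Proof.
move=> Dg g0; have := counitl S g.
rewrite Dg (tens_lift_bilin _ _ (counit_scale_bilin S)) => e.
have /eqP : ((counit S g : k) - 1) *: g = 0 by rewrite scalerBl e scale1r subrr.
by rewrite scaler_eq0 (negPf g0) orbF subr_eq0 => /eqP.
Qed.

(** The counit axiom at [x] reads x + counit(x) 1 = x. *)
Lemma counit_skew (k : fieldType) (H : falgType k) (S : hopf H) (g x : H) :
    Delta S x = tens g x + tens x 1 -> counit S g = 1 :> k ->
  counit S x = 0 :> k.
Proof.
move=> Dx g1; have := counitl S x; rewrite Dx tens_liftD.
rewrite !(tens_lift_bilin _ _ (counit_scale_bilin S)) g1 scale1r.
move/(canRL (addKr _)); rewrite addNr => /eqP.
by rewrite scaler_eq0 oner_eq0 orbF => /eqP.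
Qed.

(** * Spanning set and induction principle for T(4,2,1) *)

Definition T421_spanv (k : fieldType) (H : falgType k) (g x : H) : {vspace H} :=
  (\sum_(i < 4) (<[g ^+ i]> + <[g ^+ i * x]>))%VS.

(* By the universal property, the subalgebra generated by g and x is H. *)
Lemma T421_span (k : fieldType) (H : falgType k) (g x : H) :
    T421_presentation g x -> forall h,
  exists a b : 'I_4 -> k,
    h = \sum_i (a i *: g ^+ i + b i *: (g ^+ i * x)).
Proof.
case=> -[g4 x2 gx] ex un h; set V := T421_spanv g x.
have gV i : g ^+ i \in V /\ g ^+ i * x \in V.
  have lt4 : (i %% 4 < 4)%N by rewrite ltn_mod.
  rewrite -(expr_mod _ g4); rewrite !memvE.
  by split; apply: (sumv_sup (Ordinal lt4)) => //;
    [apply: addvSl | apply: addvSr].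
have xg i : x * g ^+ i = (-1) ^+ i *: (g ^+ i * x).
  elim: i => [|i IH]; first by rewrite scale1r mul1r mulr1.
  have xgN : x * g = - (g * x) by rewrite gx opprK.
  rewrite exprSr mulrA IH -scalerAl -[g ^+ i * x * g]mulrA xgN mulrN mulrA.
  by rewrite exprS mulN1r scaleNr scalerN.
have xgx i : x * (g ^+ i * x) = (-1) ^+ i *: (g ^+ i.+2 - g ^+ i).
  rewrite mulrA xg -scalerAl -mulrA -expr2 x2 mulrBr mulr1 -exprD.
  by rewrite addn2.
have VP (y : H) : (forall i, y * g ^+ i \in V) ->
    (forall i, y * (g ^+ i * x) \in V) -> (<[y]> * V <= V)%VS.
  move=> y1 y2; apply/prodvP => _ w /vlineP[c ->].
  rewrite -scalerAl => /memv_sumP[w' w'V ->].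
  rewrite mulr_sumr rpredZ // rpred_sum // => i _.
  have /memv_addP[_ /vlineP[a ->] [_ /vlineP[b ->] ->]] := w'V i isT.
  by rewrite mulrDr -!scalerAr rpredD // rpredZ.
(* [V] contains 1 and is stable under left multiplication by [g] and [x], hence contains the
   subalgebra they generate. *)
pose K := agenv (<[g]> + <[x]>).
have KV : (K <= V)%VS.
  apply: agenv_sub_modl; first by have [] := gV 0; rewrite -memvE expr0.
  rewrite prodvDl subv_add !VP // => i; rewrite ?xg ?xgx ?mulrA -?exprS.
  - by rewrite rpredZ // (gV _).2.
  - by rewrite rpredZ // rpredB // (gV _).1.
  - exact: (gV _).1.
  - exact: (gV _).2.
have gK : g \in K.
  by rewrite (subvP (sub_agenv _)) // (subvP (addvSl _ _)) // memv_line.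
have xK : x \in K.
  by rewrite (subvP (sub_agenv _)) // (subvP (addvSr _ _)) // memv_line.
(* [K] is an algebra in its own right in which the relations hold, so the presentation gives a
   morphism from [H] to [K]. Followed by the inclusion it fixes [g] and [x], hence is the identity,
   and every [h] lies in [K]. *)
pose Ka := agenv_aspace (<[g]> + <[x]>).
have K1 : vsval (1 : subvs_of Ka) = 1.
  by apply/eqP; rewrite algid_eq1 memvE sub1_agenv.
pose iK (v : subvs_of Ka) : H := vsval v.
have iKl : linear iK by exact: linearP.
have iKm : monoid_morphism iK by [].
pose inj := HB.pack_for {lrmorphism subvs_of Ka -> H} iK
  (GRing.isLinear.Build k (subvs_of Ka) H *:%R iK iKl)
  (GRing.isMonoidMorphism.Build _ _ iK iKm).
have [|f [fg fx]] := ex (subvs_of Ka) (Subvs gK) (Subvs xK).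
  split; apply: (val_inj : injective inj);
    by rewrite ?(rmorphM, rmorphXn, rmorphB, rmorphN, rmorph1).
have fK : inj (f h) = h.
  by apply: (un _ (inj \o f) idfun); rewrite /= ?fg ?fx.
have : h \in V by rewrite -fK (subvP KV) // subvsP.
case/memv_sumP=> w wV ->.
(* The coefficients are packed as a pair subject to a boolean equation, so that [xchoose] selects
   them for all [i] at once. *)
have {}wV (i : 'I_4): exists ab : k * k,
    w i == ab.1 *: g ^+ i + ab.2 *: (g ^+ i * x).
  have /memv_addP[_ /vlineP[a ->] [_ /vlineP[b ->] ->]] := wV i isT.
  by exists (a, b).
exists (fun i => (xchoose (wV i)).1), (fun i => (xchoose (wV i)).2).
by apply: eq_bigr => i _; apply/eqP/(xchooseP (wV i)).
Qed.

Lemma T421_ind (k : fieldType) (H : falgType k) (g x : H) (P : H -> Prop) :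
    T421_presentation g x -> P 1 ->
    (forall c a b, P a -> P b -> P (c *: a + b)) ->
    (forall h, P h -> P (g * h)) -> (forall h, P h -> P (x * h)) ->
  forall h, P h.
Proof.
move=> pr P1 Pl Pg Px h.
have P0 : P 0 by rewrite -(addNr 1) -scaleN1r; apply: Pl.
have PD a b : P a -> P b -> P (a + b) by rewrite -{2}[a]scale1r; apply: Pl.
have PZ c a : P a -> P (c *: a) by move=> Pa; rewrite -[c *: a]addr0; apply: Pl.
have Pgn y i : P y -> P (g ^+ i * y).
  move=> Py; elim: i => [|i IH]; first by rewrite expr0 mul1r.
  by rewrite exprS -mulrA; apply: Pg.
have [a [b ->]] := T421_span pr h.
apply: (big_ind P) => // i _; apply: PD; apply: PZ.
  by rewrite -[g ^+ i]mulr1; apply: Pgn.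
by apply: Pgn; rewrite -[x]mulr1; apply: Px.
Qed.

(** * The algebra k[u]/(u^4 - 1) *)

Lemma mk_monic_X4 (k : fieldType) : mk_monic ('X^4 - 1 : {poly k}) = 'X^4 - 1.
Proof. by rewrite /mk_monic size_XnsubC ?monicXnsubC. Qed.

Definition Acoef (k : fieldType) (i : nat) (a : Aalg k) : k := (polyn a)`_i.

Lemma Acoef_linear (k : fieldType) i : linear (@Acoef k i : _ -> k^o).
Proof. by move=> c a b; rewrite /Acoef /= coefD coefZ. Qed.

Lemma Agen_exp (k : fieldType) n : Agen k ^+ n = in_qpoly ('X^4 - 1) 'X^n.
Proof. by rewrite rmorphXn. Qed.

Lemma Agen4 (k : fieldType) : Agen k ^+ 4 = 1.
Proof.
have h0 : in_qpoly ('X^4 - 1 : {poly k}) ('X^4 - 1) = 0.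
  apply: val_inj; rewrite /= -[X in Pdiv.CommonRing.rmodp X]mk_monic_X4.
  exact/Pdiv.RingMonic.rmodpp/monic_mk_monic.
have := in_qpolyD ('X^4 - 1) ('X^4 - 1 : {poly k}) 1.
by rewrite subrK h0 add0r in_qpoly1 Agen_exp.
Qed.

Lemma Acoef_Agen (k : fieldType) i n : (n < 4)%N ->
  Acoef i (Agen k ^+ n) = (i == n)%:R.
Proof.
move=> n4; rewrite Agen_exp /Acoef in_qpoly_small ?coefXn //.
by rewrite mk_monic_X4 size_XnsubC // size_polyXn.
Qed.

Lemma Aexpand (k : fieldType) (a : Aalg k) :
  a = \sum_(i < 4) Acoef i a *: Agen k ^+ i.
Proof.
have sa : (size (polyn a) <= 4)%N.
  by apply: leq_trans (size_npoly a) _; rewrite mk_monic_X4 size_XnsubC.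
apply/val_inj/polyP => j; rewrite /= -/(Acoef j a).
rewrite [RHS](_ : _ = Acoef j (\sum_(i < 4) Acoef i a *: Agen k ^+ i)) //.
have [F FE] := linear_fun (@Acoef_linear k j).
rewrite [RHS]FE linear_sum /=.
under eq_bigr => i _ do rewrite linearZ /= -FE Acoef_Agen //.
have [j4|j4] := ltnP j 4.
  rewrite (bigD1 (Ordinal j4)) //= eqxx big1 ?addr0 /GRing.scale /= ?mulr1 //.
  move=> i.
  by rewrite -val_eqE /= eq_sym => /negPf ->; rewrite mulr0.
rewrite big1 => [|i _]; first by rewrite /Acoef nth_default // (leq_trans sa).
by rewrite gtn_eqF ?(leq_trans _ j4) // /GRing.scale /= mulr0.
Qed.

Lemma eq_linear_Aalg (k : fieldType) (U : lmodType k) (f f' : Aalg k -> U) :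
  linear f -> linear f' -> (forall i, f (Agen k ^+ i) = f' (Agen k ^+ i)) ->
  f =1 f'.
Proof.
move=> /linear_fun[F FE] /linear_fun[F' FE'] ff' a.
rewrite FE FE' [a]Aexpand !linear_sum; apply: eq_bigr => i _.
by rewrite !linearZ /= -FE -FE' ff'.
Qed.

Lemma Aalg_morph (k : fieldType) (B : algType k) (v : B) : v ^+ 4 = 1 ->
  exists f : {lrmorphism Aalg k -> B}, f (Agen k) = v.
Proof.
move=> v4; pose f (a : Aalg k) := horner_alg v (polyn a).
(* Evaluation at [v] kills multiples of 'X^4 - 1, so it does not see the passage to the
   remainder. *)
have fq p : f (in_qpoly ('X^4 - 1) p) = horner_alg v p.
  rewrite /f /= [in RHS](Pdiv.RingMonic.rdivp_eq (monic_mk_monic ('X^4 - 1)) p).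
  rewrite rmorphD rmorphM mk_monic_X4 rmorphB rmorphXn rmorph1 /=.
  by rewrite horner_algX v4 subrr mulr0 add0r.
have fl : linear f.
  move=> c a b; rewrite /f [polyn _](_ : _ = c *: polyn a + polyn b) //.
  by rewrite linearP /= mulr_algl.
have fm : monoid_morphism f.
  split=> [|a b]; first by rewrite /f rmorph1.
  by rewrite -[a * b]/(in_qpoly _ (polyn a * polyn b)) fq rmorphM.
exists (HB.pack_for {lrmorphism Aalg k -> B} f
  (GRing.isLinear.Build k (Aalg k) B *:%R f fl)
  (GRing.isMonoidMorphism.Build _ _ f fm)).
by rewrite /= fq horner_algX.
Qed.

(** * Primitive fourth roots of unity *)

(** A polynomial of degree at most 3 vanishing at the four distinct powers of [zeta] is zero. *)
Lemma vandermonde4 (k : fieldType) (zeta : k) (a : 'I_4 -> k) :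
  4.-primitive_root zeta ->
  (forall n : 'I_4, \sum_(i < 4) a i * zeta ^+ (i * n) = 0) ->
  forall i, a i = 0.
Proof.
move=> pz a0 i; pose p := \sum_(i < 4) a i *: 'X^i.
have pE j : p`_j = \sum_(i < 4) a i * (j == i)%:R.
  by rewrite coef_sum; apply: eq_bigr => l _; rewrite coefZ coefXn.
have p0 : p = 0.
  apply: (@roots_geq_poly_eq0 _ _ [seq zeta ^+ n | n <- iota 0 4]).
  - apply/allP => y /mapP[n]; rewrite mem_iota => /andP[_ n4] {y}->.
    rewrite rootE horner_sum; apply/eqP; rewrite -[RHS](a0 (Ordinal n4)).
    by apply: eq_bigr => l _; rewrite hornerZ hornerXn -exprM mulnC.
  - rewrite map_inj_in_uniq ?iota_uniq // => m n; rewrite !mem_iota /= => m4 n4.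
    by move/eqP; rewrite (eq_prim_root_expr pz) !modn_small // => /eqP.
  - rewrite size_map size_iota; apply: (leq_trans (size_sum _ _ _)).
    apply/bigmax_leqP => l _; apply: (leq_trans (size_scale_leq _ _)).
    by rewrite size_polyXn.
have := pE i; rewrite p0 coef0 (bigD1 i) //= eqxx mulr1 big1 ?addr0 // => j.
by rewrite -val_eqE /= eq_sym => /negPf ->; rewrite mulr0.
Qed.

Lemma prim4_sqr (k : fieldType) (zeta : k) :
  4.-primitive_root zeta -> zeta ^+ 2 = -1.
Proof.
move=> pz; have : (zeta ^+ 2) ^+ 2 == 1 by rewrite -exprM (prim_expr_order pz).
rewrite sqrf_eq1 => /orP[|/eqP //].
by rewrite -(expr0 zeta) (eq_prim_root_expr pz).
Qed.

Lemma prim4_subr1_sqr (k : fieldType) (zeta : k) : 4.-primitive_root zeta ->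
  (zeta - 1) ^+ 2 = - (2%:R * zeta) /\ zeta - 1 != 0.
Proof.
move=> pz; split; last first.
  by rewrite subr_eq0 -{1}(expr1 zeta) -(expr0 zeta) (eq_prim_root_expr pz).
by rewrite sqrrB1 (prim4_sqr pz) mulr2n mulrDl mul1r addrAC addNr add0r.
Qed.

(** The quotient is the constant c for which c u^2 (sigma u - u) = gamma u^3; its square is 2 zeta /
    (- 2 zeta). *)
Lemma prim4_divr_sqr (k : fieldType) (zeta gamma : k) :
    4.-primitive_root zeta -> gamma ^+ 2 = 2%:R * zeta ->
  (gamma / (zeta - 1)) ^+ 2 = -1.
Proof.
move=> pz ga2; have [z1 z1n0] := prim4_subr1_sqr pz.
by rewrite expr_div_n ga2 -[_ * zeta]opprK -z1 mulNr divff // sqrf_eq0.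
Qed.

(** * The inner skew derivation *)

Definition skew_der (k : fieldType) (A : comAlgType k) (u : A) (sigma : A -> A)
  (c : k) (a : A) : A := c *: (u ^+ 2 * (sigma a - a)).

Lemma lrmorph_eigenX (k : fieldType) (A B : algType k) (u : A) (v : B)
    (zeta : k) (sigma : {lrmorphism A -> B}) n :
  sigma u = zeta *: v -> sigma (u ^+ n) = zeta ^+ n *: v ^+ n.
Proof. by move=> su; rewrite rmorphXn /= su exprZn. Qed.

Lemma skew_der_linear (k : fieldType) (A : comAlgType k) (u : A)
    (sigma : {lrmorphism A -> A}) c : linear (skew_der u sigma c).
Proof.
move=> d a b; rewrite /skew_der linearP opprD addrACA -scalerN -scalerDr mulrDr.
by rewrite -scalerAr scalerDr !scalerA mulrC.
Qed.

Lemma skew_derM (k : fieldType) (A : comAlgType k) (u : A)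
    (sigma : {lrmorphism A -> A}) c a b :
  skew_der u sigma c (a * b) =
  sigma a * skew_der u sigma c b + skew_der u sigma c a * b.
Proof.
rewrite /skew_der rmorphM /= -scalerAr -scalerAl -scalerDr; congr (_ *: _).
rewrite [sigma a * (_ * _)]mulrCA -[_ * _ * b]mulrA -mulrDr; congr (_ * _).
by rewrite mulrBr mulrBl addrA subrK.
Qed.

Section Skew.

Context (k : fieldType) (A : comAlgType k) (u : A) (zeta c : k)
  (sigma : {lrmorphism A -> A}).
Context (su : sigma u = zeta *: u).

Lemma skew_derX n : 
  skew_der u sigma c (u ^+ n) = (c * (zeta ^+ n - 1)) *: u ^+ (n + 2).
Proof.
rewrite /skew_der (lrmorph_eigenX _ su) -{2}(scale1r (_ ^+ n)) -scalerBl.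
by rewrite -scalerAr scalerA -exprD addnC.
Qed.

Context (z2 : zeta ^+ 2 = -1).

Lemma sigma4X n : sigma (sigma (sigma (sigma (u ^+ n)))) = u ^+ n.
Proof.
have s2 : sigma (sigma u) = - u.
  by rewrite su linearZ /= su scalerA -expr2 z2 scaleN1r.
by rewrite !rmorphXn /= s2 !rmorphN /= s2 opprK.
Qed.

(** The sign is that of sigma(u^2) = zeta^2 u^2 = - u^2; it realises the relation g x = - x g. *)
Lemma sigma_skew_der a :
  sigma (skew_der u sigma c a) = - skew_der u sigma c (sigma a).
Proof.
rewrite /skew_der linearZ /= rmorphM /= (lrmorph_eigenX 2 su) z2.
by rewrite scaleN1r mulNr scalerN rmorphB.
Qed.

Lemma skew_der_sqr a : u ^+ 4 = 1 -> c ^+ 2 = -1 ->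
  skew_der u sigma c (skew_der u sigma c a) = sigma (sigma a) - a.
Proof.
move=> u4 c2; rewrite {1}/skew_der sigma_skew_der /skew_der.
rewrite -opprD -scalerDr -mulrDr mulrN -scalerAr mulrA -exprD u4 mul1r.
by rewrite scalerN scalerA -expr2 c2 scaleN1r opprK addrA subrK.
Qed.

End Skew.

(** * Modules from the presentation *)

Definition comp_lfun_lalgMixin (k : comNzRingType) (V : vectType k)
    (pV : (0 < dim V)%N) :=
  GRing.Lmodule_isLalgebra.Build k (lfun_comp_nzRingType pV)
    (fun c f g => comp_lfunZl c f g).

(* Unlike lfun_algType, whose product is the reversed composition. *)
Definition comp_lfun_lalgType (k : comNzRingType) (V : vectType k)
    (pV : (0 < dim V)%N) : lalgType k :=
  HB.pack 'End(V) (lfun_comp_nzRingType pV) (comp_lfun_lalgMixin pV).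

Definition comp_lfun_algType (k : comNzRingType) (V : vectType k)
    (pV : (0 < dim V)%N) : algType k :=
  HB.pack 'End(V) (comp_lfun_lalgType pV)
   (GRing.Lalgebra_isAlgebra.Build k (comp_lfun_lalgType pV)
     (fun c f g => comp_lfunZr c f g)).

Lemma linear_lfun (k : fieldType) (V W : vectType k) (f : V -> W) :
  linear f -> exists F : 'Hom(V, W), f =1 F.
Proof. by case/linear_fun=> F FE; exists (linfun F) => v; rewrite lfunE. Qed.

(** The universal property, applied to the endomorphism algebra. Multiplicativity is spelled out
    with [\o], so that later proofs do not depend on the ring structure chosen on 'End(V). *)
Lemma T421_rep (k : fieldType) (H : falgType k) (g x : H) (V : vectType k)
    (b c : V -> V) :
  (0 < dim V)%N -> T421_presentation g x -> linear b -> linear c ->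
  (forall v, b (b (b (b v))) = v) -> (forall v, c (c v) = b (b v) - v) ->
  (forall v, b (c v) = - c (b v)) ->
  exists F : H -> 'End(V), [/\ linear F, F 1 = \1%VF,
    forall h h', F (h * h') = (F h \o F h')%VF, F g =1 b & F x =1 c].
Proof.
move=> pV [_ ex _] /linear_lfun[b' bE] /linear_lfun[c' cE] b4 c2 bc.
have [|F [Fg Fx]] := ex (comp_lfun_algType pV) b' c'.
  have compE (f f' : comp_lfun_algType pV) v :
    ((f * f') : 'End(V)) v = (f : 'End(V)) ((f' : 'End(V)) v).
    exact: comp_lfunE.
  have oneE v : ((1 : comp_lfun_algType pV) : 'End(V)) v = v by exact: id_lfunE.
  split; apply/lfunP => v.
  - by rewrite !exprS expr0 !compE !oneE -!bE b4.
  - rewrite !expr2 compE [RHS]add_lfunE [X in _ + X]opp_lfunE compE oneE.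
    by rewrite -!cE -!bE c2.
  - by rewrite compE [RHS]opp_lfunE compE -!bE -!cE bc.
exists F; split.
- exact: (linearP F).
- exact: (rmorph1 F).
- exact: (rmorphM F).
- by move=> v; rewrite Fg bE.
- by move=> v; rewrite Fx cE.
Qed.

(** * Product rules for the generators *)

Lemma grouplikeX (k : fieldType) (H : falgType k) (S : hopf H) (g : H) i :
  Delta S g = tens g g -> Delta S (g ^+ i) = tens (g ^+ i) (g ^+ i).
Proof.
move=> Dg; elim: i => [|i IH]; first by rewrite !expr0 Delta1.
rewrite exprS DeltaM Dg IH tens_lift_bilin; last first.
  exact/bilin_tens_mul/tens_bilin.
by rewrite tens_lift_bilin // ; split=> u c v w;
  rewrite mulrDr -scalerAr ?tens_linearl ?tens_linearr.
Qed.

Lemma bilin_mull (k : fieldType) (H : falgType k) (U : lmodType k)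
    (f : H -> H -> U) (a b : H) :
  bilin f -> bilin (fun h1 h2 => f (a * h1) (b * h2)).
Proof.
by case=> fl fr; split=> u c v w; rewrite mulrDr -scalerAr ?fl ?fr.
Qed.

Lemma bilin_act_mul (k : fieldType) (H : falgType k) (B : algType k)
    (F : H -> B -> B) a b : (forall b, linear (F^~ b)) ->
  bilin (fun h1 h2 => F h1 a * F h2 b).
Proof.
move=> Fl; split=> h c h1 h2; rewrite Fl.
  by rewrite mulrDl scalerAl.
by rewrite mulrDr scalerAr.
Qed.

Section Module.

Context (k : fieldType) (H : falgType k) (S : hopf H) (B : algType k)
  (M : module_algebra S B).

Lemma act_grouplike_mul (g : H) a b :
  Delta S g = tens g g -> M g (a * b) = M g a * M g b.
Proof.
move=> Dg; rewrite act_mul Dg tens_lift_bilin //.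
by apply: bilin_act_mul => c; apply: act_linearl.
Qed.

Lemma act_skew_mul (g x : H) a b : Delta S x = tens g x + tens x 1 ->
  M x (a * b) = M g a * M x b + M x a * b.
Proof.
have bm := bilin_act_mul a b (act_linearl M).
by move=> Dx; rewrite act_mul Dx tens_liftD !tens_lift_bilin // act1.
Qed.

End Module.

(** * Uniqueness and existence of the action *)

(** The product rules propagate agreement from u to its powers, and [T421_ind] propagates it from
    the generators to all of [H]. *)
Lemma T421_act_uniq (k : fieldType) (H : falgType k) (S : hopf H) (g x : H)
    (M M' : module_algebra S (Aalg k)) : is_T421 S g x ->
  M g (Agen k) = M' g (Agen k) -> M x (Agen k) = M' x (Agen k) ->
  forall h a, M h a = M' h a.
Proof.
case=> pr Dg Dx eg ex.
have eg' : M g =1 M' g.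
  apply: eq_linear_Aalg => [||i]; try exact: act_linearr.
  elim: i => [|i IH]; first by rewrite !act_one.
  by rewrite exprS !(act_grouplike_mul _ _ _ Dg) eg IH.
have ex' : M x =1 M' x.
  apply: eq_linear_Aalg => [||i]; try exact: act_linearr.
  elim: i => [|i IH]; first by rewrite !act_one.
  by rewrite exprS !(act_skew_mul _ _ _ Dx) eg ex IH.
apply: (T421_ind pr) => [a|c h h' hE hE' a|h hE a|h hE a].
- by rewrite !act1.
- by rewrite !act_linearl hE hE'.
- by rewrite !actM hE eg'.
- by rewrite !actM hE ex'.
Qed.

Lemma T421_counit (k : fieldType) (H : falgType k) (S : hopf H) (g x : H) :
  is_T421 S g x -> counit S g = 1 :> k /\ counit S x = 0 :> k.
Proof.
case=> -[[g4 _ _] _ _] Dg Dx.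
have g0 : g != 0.
  by apply: contra_eq_neq g4 => ->; rewrite expr0n eq_sym oner_eq0.
have eg := counit_grouplike Dg g0.
by split; last exact: counit_skew Dx eg.
Qed.

Lemma T421_act_exists (k : fieldType) (H : falgType k) (S : hopf H) (g x : H)
    (zeta c : k) : is_T421 S g x -> 4.-primitive_root zeta -> c ^+ 2 = -1 ->
  exists (M : module_algebra S (Aalg k))
    (sigma : {lrmorphism Aalg k -> Aalg k}),
    [/\ sigma (Agen k) = zeta *: Agen k, M g =1 sigma
      & M x =1 skew_der (Agen k) sigma c].
Proof.
move=> hT pz c2; have [eg ex] := T421_counit hT; case: hT => pr Dg Dx.
have z2 := prim4_sqr pz.
have u4 := Agen4 k.
have [|sigma su] := @Aalg_morph k _ (zeta *: Agen k).
  by rewrite exprZn (prim_expr_order pz) u4 scale1r.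
have sss a : sigma (sigma (sigma (sigma a))) = a.
  have ssl : linear (fun a => sigma (sigma (sigma (sigma a)))).
    by move=> d a1 a2; rewrite !linearP.
  apply: (eq_linear_Aalg ssl (f' := id)) => // i.
  by rewrite (sigma4X su z2).
have [|F [Fl F1 FM Fg Fx]] := @T421_rep k H g x (Aalg k) sigma
  (skew_der (Agen k) sigma c) _ pr (linearP sigma)
  (skew_der_linear (Agen k) sigma c) sss
  (fun a => skew_der_sqr su z2 a u4 c2) (sigma_skew_der c su z2).
  by rewrite /dim /= mk_monic_X4 size_XnsubC.
have Fll b : linear (fun h => F h b).
  by move=> d h h'; rewrite Fl add_lfunE scale_lfunE.
have Fr h : linear (F h) by exact: linearP.
(* By induction on [h]: passing to g h uses that [sigma] is multiplicative, and passing to x h uses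
   [skew_derM], whose two terms match those of [Delta S x]. *)
have Fm h a b :
    F h (a * b) = tens_lift (fun h1 h2 => F h1 a * F h2 b) (Delta S h).
  have bm := bilin_act_mul a b Fll.
  move: h a b bm.
  apply: (T421_ind pr) => [a b bm|d h h' hE hE' a b bm|h hE a b bm|h hE a b bm].
  - by rewrite Delta1 tens_lift_bilin // F1 !id_lfunE.
  - by rewrite linearP tens_lift_linear Fll hE // hE'.
  - rewrite (tens_lift_grouplikeM _ bm Dg) FM comp_lfunE hE //.
    rewrite (linear_tens_lift _ _ (Fr g)).
    apply: eq_tens_lift => h1 h2.
    by rewrite !FM !comp_lfunE !Fg rmorphM.
  - rewrite (tens_lift_skewM _ bm Dx) FM comp_lfunE hE //.
    rewrite (linear_tens_lift _ _ (Fr x)).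
    apply: eq_tens_lift => h1 h2.
    by rewrite !FM !comp_lfunE !Fx !Fg skew_derM.
have Fo h : F h 1 = (counit S h : k) *: 1.
  move: h; apply: (T421_ind pr) => [|d h h' hE hE'|h hE|h hE].
  - by rewrite F1 id_lfunE rmorph1 scale1r.
  - by rewrite Fll hE hE' linearP scalerDl scalerA.
  - by rewrite FM comp_lfunE hE linearZ /= Fg rmorph1 rmorphM /= eg mul1r.
  - rewrite FM comp_lfunE hE linearZ /= Fx rmorphM /= ex mul0r scale0r.
    by rewrite /skew_der rmorph1 subrr mulr0 !scaler0.
have Fa1 b : F 1 b = b by rewrite F1 id_lfunE.
have FaM h h' b : F (h * h') b = F h (F h' b) by rewrite FM comp_lfunE.
by exists (ModuleAlgebra Fll Fr Fa1 FaM Fm Fo), sigma.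
Qed.

(** * Inner-faithfulness *)

Lemma AcoefZ (k : fieldType) i c (a : Aalg k) :
  Acoef i (c *: a) = c * Acoef i a.
Proof. by rewrite /Acoef /= coefZ. Qed.

Lemma Acoef_AgenX (k : fieldType) i n :
  Acoef i (Agen k ^+ n) = (i == (n %% 4)%N)%:R.
Proof. by rewrite -(expr_mod _ (Agen4 k)) Acoef_Agen ?ltn_mod. Qed.

Lemma act_eigenX (k : fieldType) (H : falgType k) (S : hopf H) (B : algType k)
    (M : module_algebra S B) (g : H) (z : k) (b : B) i :
  M g b = z *: b -> M (g ^+ i) b = z ^+ i *: b.
Proof.
move=> gb; elim: i => [|i IH]; first by rewrite !expr0 act1 scale1r.
have [L LE] := linear_fun (act_linearr M g).
by rewrite exprS actM IH LE linearZ /= -LE gb scalerA -exprSr.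
Qed.

(* h.u^2 for h = g^i x is a nonzero multiple of 1 not depending on i, whence   *)
(* the choice of u^2 in psi.                                                   *)
Lemma T421_ideal_trivial (k : fieldType) (H : falgType k) (S : hopf H)
    (g x : H) (zeta c : k) (M : module_algebra S (Aalg k))
    (sigma : {lrmorphism Aalg k -> Aalg k}) (I : {vspace H}) :
    is_T421 S g x -> 4.-primitive_root zeta -> c ^+ 2 = -1 ->
    sigma (Agen k) = zeta *: Agen k -> M g =1 sigma ->
    M x =1 skew_der (Agen k) sigma c ->
    hopf_ideal S I -> (forall h a, h \in I -> M h a = 0) ->
  I = 0%VS.
Proof.
case=> pr Dg Dx pz c2 su Mg Mx hI I0.
apply/eqP; rewrite -subv0; apply/subvP => h hh; rewrite memv0.
have gX i n : M (g ^+ i) (Agen k ^+ n) = (zeta ^+ n) ^+ i *: Agen k ^+ n.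
  by apply: act_eigenX; rewrite Mg; exact: lrmorph_eigenX su.
have gxX i n : M (g ^+ i * x) (Agen k ^+ n) =
    (c * (zeta ^+ n - 1) * (zeta ^+ (n + 2)) ^+ i) *: Agen k ^+ (n + 2).
  rewrite actM Mx (skew_derX c su n).
  have [L LE] := linear_fun (act_linearr M (g ^+ i)).
  by rewrite LE linearZ /= -LE gX scalerA.
have [a [b hE]] := T421_span pr h.
(* [g] preserves degree in u and [x] shifts it by 2 modulo 4. Hence [chi n] sees only the terms g^i,
   and [psi] only the terms g^i x. *)
pose chi n y : k^o := Acoef n (M y (Agen k ^+ n)).
pose psi y : k^o := Acoef 0 (M y (Agen k ^+ 2)).
have coef_lin j n : linear (fun y => Acoef j (M y (Agen k ^+ n)) : k^o).
  by move=> d y y'; rewrite act_linearl Acoef_linear.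
have chil n : linear (chi n) by exact: coef_lin.
have psil : linear psi by exact: coef_lin.
have chi_g (n : 'I_4) i : chi n (g ^+ i) = zeta ^+ (i * n).
  by rewrite /chi gX AcoefZ Acoef_AgenX modn_small // eqxx mulr1 -exprM mulnC.
have chi_gx (n : 'I_4) i : chi n (g ^+ i * x) = 0.
  rewrite /chi gxX AcoefZ Acoef_AgenX.
  by case: n => -[|[|[|[|]]]] //= _; rewrite mulr0.
have psi_g i : psi (g ^+ i) = 0 by rewrite /psi gX AcoefZ Acoef_AgenX mulr0.
have psi_gx i : psi (g ^+ i * x) = - (2%:R * c).
  rewrite /psi gxX AcoefZ Acoef_AgenX (prim_expr_order pz) expr1n !mulr1.
  by rewrite (prim4_sqr pz) -opprD mulrN mulrC.
have a0 : forall i, a i = 0.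
  apply: (vandermonde4 pz) => n.
  have [L LE] := linear_fun (chil n).
  have : chi n h = 0 by rewrite /chi I0 // /Acoef coef0.
  rewrite hE LE linear_sum => e; rewrite -[RHS]e; apply: eq_bigr => i _.
  by rewrite linearD !linearZ /= -!LE chi_g chi_gx scaler0 addr0.
have b0 : forall i, b i = 0.
  apply: (vandermonde4 pz) => n.
  (* [chi n] and [psi] both vanish on [I], so [f] qualifies for [hopf_ideal_kill]. *)
  pose f y z : k^o := chi n y * psi z.
  have bf : bilin f.
    split=> y d z w; rewrite /f ?chil ?psil ?mulrDl ?mulrDr //.
      by rewrite -mulrA.
    by rewrite mulrCA.
  have f0 y z : y \in I -> f y z = 0 /\ f z y = 0.
    by move=> yI; rewrite /f /chi /psi !(I0 _ _ yI) /Acoef !coef0 mul0r mulr0.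
  have : tens_lift f (Delta S h) = 0 := hopf_ideal_kill hI bf f0 hh.
  have [L LE] := linear_fun (tens_lift_linear f).
  rewrite hE linear_sum LE linear_sum /=.
  (* Delta(g^i x) = g^(i+1) (x) g^i x + g^i x (x) g^i. As [psi] kills powers of g, only the first
     tensor contributes, with value - 2 c zeta^((i+1) n). *)
  under eq_bigr => i _.
    rewrite linearD !linearZ /= linearD !linearZ /= -!LE grouplikeX //.
    rewrite tens_lift_bilin // (tens_lift_grouplikeM _ bf (grouplikeX i Dg)) Dx.
    rewrite tens_liftD !(tens_lift_bilin _ _ (bilin_mull _ _ bf)) mulr1 -exprSr.
    rewrite /f psi_g psi_gx !mulr0 addr0 scaler0 add0r chi_g mulSn exprD.
    rewrite /GRing.scale /= -mulrA mulrCA [a in _ * a]mulrA.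
    over.
  rewrite -mulr_sumr => /eqP; rewrite mulf_eq0.
  rewrite -mulr_suml !mulf_eq0 oppr_eq0 mulf_eq0.
  have cn0 : c != 0.
    by apply: contra_eq_neq c2 => ->; rewrite expr0n eq_sym oppr_eq0 oner_eq0.
  have [/eqP z1 /negPf z1n0] := prim4_subr1_sqr pz.
  (* Both 2 and [zeta] divide (zeta - 1)^2 = - 2 zeta, which is nonzero. *)
  have n2 : 2%:R != 0 :> k.
    by apply: contraFneq z1n0 => n2; rewrite -sqrf_eq0 (eqP z1) n2 mul0r oppr0.
  have zn0 : zeta != 0.
    apply: contraFneq z1n0 => zn0.
    by rewrite -sqrf_eq0 (eqP z1) zn0 mulr0 oppr0.
  by rewrite expf_eq0 (negPf zn0) andbF (negPf n2) (negPf cn0) !orbF => /eqP.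
by rewrite hE big1 // => i _; rewrite a0 b0 !scale0r addr0.
Qed.


(** An element acting nontrivially is found constructively: whether [I] kills A is decided by four
    subspace inclusions, one for each basis power of u. *)
Lemma inner_faithfulI (k : fieldType) (H : falgType k) (S : hopf H)
    (M : module_algebra S (Aalg k)) :
  (forall I, hopf_ideal S I -> (forall h a, h \in I -> M h a = 0) ->
    I = 0%VS) ->
  inner_faithful M.
Proof.
move=> triv I hI I0.
pose L (j : nat) := HB.pack_for {linear H -> Aalg k} (M^~ (Agen k ^+ j))
  (GRing.isLinear.Build k H (Aalg k) *:%R _ (act_linearl M (Agen k ^+ j))).
have [/forallP kill|] := boolP [forall j : 'I_4, (I <= lker (linfun (L j)))%VS].
  case/eqP: I0; apply: triv => // h a hh.
  have [F FE] := linear_fun (act_linearr M h).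
  rewrite [a]Aexpand FE linear_sum big1 // => i _.
  have /subvP/(_ h hh) := kill i; rewrite memv_ker lfunE /= => /eqP hi.
  by rewrite linearZ /= -FE hi scaler0.
rewrite negb_forall => /existsP[j /subvPn[h hh]].
by rewrite memv_ker lfunE /= => hj; exists h => //; exists (Agen k ^+ j).
Qed.

(** * Classification of the actions *)

(** The product rule gives x.v^3 = gamma (1 + zeta + zeta^2) v = gamma zeta v, so x^2.v = gamma^2
    zeta v, while (g^2 - 1).v = - 2 v. *)
Lemma skew_weight (k : fieldType) (H : falgType k) (S : hopf H) (g x : H)
    (B : algType k) (M : module_algebra S B) (v : B) (zeta gamma : k) :
    is_T421 S g x -> v ^+ 4 = 1 -> zeta ^+ 2 = -1 -> M g v = zeta *: v ->
    M x v = gamma *: v ^+ 3 ->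
  gamma ^+ 2 = 2%:R * zeta.
Proof.
case=> -[[_ x2 _] _ _] Dg Dx v4 z2 gv xv.
have [L LE] := linear_fun (act_linearr M x).
have xv2 : M x (v ^+ 2) = (gamma * (1 + zeta)) *: 1.
  rewrite expr2 (act_skew_mul _ _ _ Dx) gv xv -scalerAl -!scalerAr -scalerAl.
  by rewrite -exprS -exprSr v4 scalerA -scalerDl mulrDr mulr1 addrC mulrC.
have xv3 : M x (v ^+ 3) = (gamma * zeta) *: v.
  rewrite exprS (act_skew_mul _ _ _ Dx) gv xv xv2 -!scalerAl -!scalerAr -exprD.
  rewrite -(expr_mod _ v4) expr1 mulr1 scalerA -scalerDl.
  rewrite mulrCA mulrDr mulr1 -expr2 z2 addrC -{1}[gamma]mulr1 -mulrDr.
  by rewrite addrCA subrr addr0.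
have : M (x ^+ 2) v = (gamma ^+ 2 * zeta) *: v.
  by rewrite expr2 actM xv LE linearZ /= -LE xv3 scalerA mulrA -expr2.
have [G GE] := linear_fun (act_linearl M v).
have v0 : v != 0.
  by apply: contra_eq_neq v4 => ->; rewrite expr0n eq_sym oner_eq0.
rewrite x2 GE linearB /= -!GE (act_eigenX 2 gv) act1 z2 -[X in _ - X]scale1r.
rewrite -scalerBl.
move/eqP; rewrite -subr_eq0 -scalerBl scaler_eq0 (negPf v0) orbF subr_eq0.
move=> /eqP e.
(* Multiplying gamma^2 zeta = -2 by [zeta], with zeta^2 = -1, isolates gamma^2. *)
have := congr1 ( *%R^~ zeta) e.
rewrite -mulrA -expr2 z2 mulrN1 => /(canLR (@opprK _)) <-.
by rewrite -mulNr opprB opprK.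
Qed.

(** By g x = - x g, the vector x.u has g-eigenvalue - zeta = zeta^3, and among the basis powers only
    u^3 has this eigenvalue. *)
Lemma skew_eigen (k : fieldType) (H : falgType k) (S : hopf H) (g x : H)
    (B : algType k) (M : module_algebra S B) (f : {lrmorphism Aalg k -> B})
    (zeta : k) :
    is_T421 S g x -> bijective f -> 4.-primitive_root zeta ->
    M g (f (Agen k)) = zeta *: f (Agen k) ->
  exists gamma, M x (f (Agen k)) = gamma *: f (Agen k) ^+ 3.
Proof.
move=> hT bf pz gv; have [eg _] := T421_counit hT.
case: hT => -[[_ _ gx] _ _] Dg Dx.
have gX i : M g (f (Agen k ^+ i)) = zeta ^+ i *: f (Agen k ^+ i).
  rewrite rmorphXn /=; elim: i => [|i IH].
    by rewrite act_one eg.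
  rewrite exprS (act_grouplike_mul _ _ _ Dg) gv IH -scalerAl -scalerAr scalerA.
  by rewrite -[zeta * _]exprS.

case: (bf) => f' f'K fK; pose a := f' (M x (f (Agen k))).
have [L LE] := linear_fun (act_linearr M g).
have [X XE] := linear_fun (act_linearr M x).
have gy : M g (f a) = - zeta *: f a.
  rewrite fK -actM gx; have [G GE] := linear_fun (act_linearl M (f (Agen k))).
  by rewrite GE linearN /= -GE actM gv XE linearZ /= -XE scaleNr.
have fa : f a = \sum_(j < 4) Acoef j a *: f (Agen k ^+ j).
  by rewrite {1}[a]Aexpand linear_sum; apply: eq_bigr => j _; rewrite linearZ.
(* This compares coefficients in g.y + zeta y = 0 for y = x.u; the scalar factor vanishes only at i
   = 3. *)
have a0 i : (i < 4)%N -> (zeta ^+ i + zeta) * Acoef i a = 0.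
  move=> i4.
  have sa : \sum_(j < 4) (Acoef j a * (zeta ^+ j + zeta)) *: Agen k ^+ j = 0.
    apply: (can_inj f'K); rewrite linear0 linear_sum.
    have e0 : M g (f a) + zeta *: f a = 0 by rewrite gy scaleNr addNr.
    rewrite -[RHS]e0.
    rewrite fa LE linear_sum scaler_sumr -big_split.
    apply: eq_bigr => j _; rewrite /= !linearZ /= -LE gX !scalerA -scalerDl.
    by rewrite mulrDr.
  have [A AE] := linear_fun (@Acoef_linear k i).
  have := congr1 (@Acoef k i) sa; rewrite [in RHS]/Acoef coef0 => e0.
  rewrite -[RHS]e0.
  rewrite [RHS]AE linear_sum (bigD1 (Ordinal i4)) //= big1 => [|j].
    by rewrite addr0 -AE AcoefZ Acoef_Agen // eqxx mulr1 mulrC.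
  rewrite -val_eqE /= -AE AcoefZ Acoef_Agen // eq_sym => /negPf->.
  by rewrite mulr0.
exists (Acoef 3 a); rewrite -(fK (M x _)) -/a {1}[a]Aexpand -rmorphXn -linearZ.
congr (f _); rewrite !big_ord_recr big_ord0 /=.
have z3 : zeta ^+ 3 = - zeta by rewrite exprS (prim4_sqr pz) mulrN1.
have c0 i : (i < 3)%N -> Acoef i a = 0.
  move=> i3; have i4 : (i < 4)%N := ltnW i3.
  have /eqP := a0 i i4; rewrite mulf_eq0 => /orP[|/eqP //].
  rewrite addr_eq0 -z3 (eq_prim_root_expr pz) !modn_small //.
  by rewrite ltn_eqF.
by rewrite (c0 0) // (c0 1) // (c0 2) // !scale0r !add0r.
Qed.

Theorem proposition5p3 (k : closedFieldType) (hk : [pchar k] =i pred0)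
    (H : falgType k) (S : hopf H) (g x : H) (hT : is_T421 S g x) :
  (forall zeta gamma : k, 4.-primitive_root zeta -> gamma ^+ 2 = 2%:R * zeta ->
     exists M : module_algebra S (Aalg k),
       [/\ M g (Agen k) = zeta *: Agen k,
           M x (Agen k) = gamma *: Agen k ^+ 3,
           A_T421 g M idfun
         & forall M' : module_algebra S (Aalg k),
             M' g (Agen k) = zeta *: Agen k ->
             M' x (Agen k) = gamma *: Agen k ^+ 3 ->
             forall (h : H) (a : Aalg k), M' h a = M h a]) /\
  (forall (B : algType k) (M : module_algebra S B)
      (f : {lrmorphism Aalg k -> B}),
     A_T421 g M f ->
     exists zeta gamma : k,
       [/\ 4.-primitive_root zeta, gamma ^+ 2 = 2%:R * zeta,
           M g (f (Agen k)) = zeta *: f (Agen k)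
         & M x (f (Agen k)) = gamma *: f (Agen k) ^+ 3]).
Proof.
split=> [zeta gamma pz ga2|B M f [_ bf [zeta pz gv]]]; last first.
  have [gamma xv] := skew_eigen hT bf pz gv.
  exists zeta, gamma; split=> //.
  apply: skew_weight hT _ (prim4_sqr pz) gv xv.
  by rewrite -rmorphXn Agen4 rmorph1.
have c2 := prim4_divr_sqr pz ga2.
have [M [sigma [su Mg Mx]]] := T421_act_exists hT pz c2.
have Mgu : M g (Agen k) = zeta *: Agen k by rewrite Mg.
have Mxu : M x (Agen k) = gamma *: Agen k ^+ 3.
  (* At n = 1 the coefficient is c (zeta - 1), which is gamma by the choice of c. *)
  rewrite Mx; have := skew_derX (gamma / (zeta - 1)) su 1; rewrite !expr1 => ->.
  by rewrite divfK //; have [] := prim4_subr1_sqr pz.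
exists M; split=> // [|M' M'g M'x]; last first.
  by apply: (T421_act_uniq hT); rewrite ?Mgu ?Mxu.
split; last by exists zeta.
  by apply: inner_faithfulI => I; apply: (T421_ideal_trivial hT pz c2 su Mg Mx).
by exists id.
Qed.
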